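(* Let $x^0\in\mathbb{R}^n$ and let $S=[s^1\;\cdots\; s^n]\in\mathbb{R}^{n\times n}$ be full rank. Select $k\in\{0,1,\dots,n\}$ and let $U_0=S$ and, if $k\neq 0$, let $U_k\in\mathbb{R}^{n\times n}$ be the matrix whose $k$-th column is $-s^k$ and whose $i$-th column is $s^i-s^k$ for $i\neq k$. Then the set $\mathcal{M}(x^0;S,U_k)$ is poised for quadratic interpolation.
   Context: For $S=[s^1\cdots s^n]$, $T=[t^1\cdots t^n]\in\mathbb{R}^{n\times n}$, let $$\mathcal{S}(x^0;S,T)=\{x^0\}\cup\{x^0+s^i\}_{i}\cup\{x^0+t^j\}_{j}\cup\{x^0+s^i+t^j\}_{i,j}$$ (the set of distinct points used in computing the nested-set Hessian at $x^0$ over $S$ and $T$). It is called a minimal poised set for NSHC (nested-set Hessian computation) at $x^0$ if $S$ and $T$ are full rank and it contains exactly $(n+1)(n+2)/2$ distinct points. For $S$ full rank, $\mathcal{M}(x^0;S,U_k)$ denotes the minimal poised set $\mathcal{S}(x^0;S,U_k)$. A set of distinct points $\mathcal{Y}=\{y^0,y^1,\dots,y^m\}\subset\mathbb{R}^n$ with $m=\frac12(n+1)(n+2)-1$ is poised for quadratic interpolation if the system $$\alpha_0+\alpha^\top y^i+\tfrac12 (y^i)^\top \mathbf{H}y^i=0,\quad i\in\{0,1,\dots,m\},$$ has a unique solution for $\alpha_0\in\mathbb{R}$, $\alpha\in\mathbb{R}^n$ and $\mathbf{H}=\mathbf{H}^\top\in\mathbb{R}^{n\times n}$. *)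

(* Defs.v *)
From mathcomp Require Import all_boot all_order all_algebra finmap reals.

Set Implicit Arguments.
Unset Strict Implicit.
Unset Printing Implicit Defensive.

Import GRing.Theory Num.Theory.
Local Open Scope fset_scope.
Local Open Scope ring_scope.

(* Points of R^n are column vectors; s^i is [col i S]. An [{fset _}] is
   extensional, so coinciding points are counted once. *)
Definition nested_points (R : realType) (n : nat) (x0 : 'cV[R]_n)
    (S T : 'M[R]_n) : {fset 'cV[R]_n} :=
  [fset x0]
  `|` [fset x0 + col i S | i in 'I_n]
  `|` [fset x0 + col j T | j in 'I_n]
  `|` [fset x0 + col i S + col j T | i in 'I_n, j in 'I_n].

Definition minimal_poised_nshc (R : realType) (n : nat) (x0 : 'cV[R]_n)
    (S T : 'M[R]_n) : Prop :=
  [/\ \rank S = n, \rank T = n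
    & #|` nested_points x0 S T| = ((n.+1 * n.+2)./2)%N].

Definition quad_eval (R : realType) (n : nat) (a0 : R) (a : 'cV[R]_n)
    (H : 'M[R]_n) (y : 'cV[R]_n) : R :=
  a0 + (a^T *m y) 0 0 + 2^-1 * (y^T *m H *m y) 0 0.

Definition poised_quadratic (R : realType) (n : nat)
    (Y : {fset 'cV[R]_n}) : Prop :=
  #|` Y| = ((n.+1 * n.+2)./2)%N /\
  exists! q : R * 'cV[R]_n * 'M[R]_n,
    q.2^T = q.2 /\ forall y, y \in Y -> quad_eval q.1.1 q.1.2 q.2 y = 0.

(* [k] ranges over {0, ..., n}, whereas columns are numbered from 0: for
   k <> 0, [unlift ord0 k] is [Some l] with l = k - 1, the position of s^k. *)
Definition Umx (R : realType) (n : nat) (S : 'M[R]_n) (k : 'I_n.+1) :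
    'M[R]_n :=
  if unlift ord0 k is Some l
  then \matrix_(r, i) (if i == l then - S r l else S r i - S r l)
  else S.

(* Main.v *)
Require Import Defs.
From mathcomp Require Import all_boot all_order all_algebra finmap reals.
From mathcomp Require Import ring lra.

(** Put v_0 = 0 and v_i = s^i for i = 1, ..., n; these are the vertices of a
    nondegenerate simplex.  The columns of U_k are exactly the edge vectors
    v_a - v_k with a <> k, so for every k, including k = 0, the nested set is
    the same second-order simplex lattice, up to translation:
      { c + v_a + v_b : 0 <= a, b <= n }   with c = x0 - v_k
    ([nested_points_lattice]).  This symmetric description gives both claims.

    Counting.  The s^i are linearly independent, so v_a + v_b determines the
    unordered pair {a, b} ([vertex_pair_inj]), and there are (n+1)(n+2)/2 such
    pairs.  The matrix U_k has full rank because the operation S |-> U_k is an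
    involution of the form S |-> S E: it exchanges the vertices v_0 and v_k of
    the simplex and moves the origin to the new v_0.

    Poisedness.  Recentred at c, a quadratic vanishing on the set becomes a
    quadratic F(d) = F(0) + b.d + d.Hd/2 that vanishes at every v_a + v_b.
    As v_0 = 0, this includes F(0) = F(s^i) = 0, and then
      0 = F(s^i + s^j) - F(s^i) - F(s^j) + F(0) = s^i.H s^j,
    so H = 0 because the s^i form a basis; now F(s^i) = 0 reads b.s^i = 0, so
    b = 0 ([quad_lattice_eq0]). *)

Set Implicit Arguments.
Unset Strict Implicit.
Unset Printing Implicit Defensive.

Import GRing.Theory Num.Theory.
Local Open Scope fset_scope.
Local Open Scope ring_scope.

Definition vertex (R : realType) (n : nat) (S : 'M[R]_n) (a : 'I_n.+1) :
    'cV[R]_n :=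
  if unlift ord0 a is Some i then col i S else 0.

Lemma vertex0 (R : realType) (n : nat) (S : 'M[R]_n) : vertex S ord0 = 0.
Proof. by rewrite /vertex unlift_none. Qed.

Lemma vertex_lift (R : realType) (n : nat) (S : 'M[R]_n) (i : 'I_n) :
  vertex S (lift ord0 i) = col i S.
Proof. by rewrite /vertex liftK. Qed.

Lemma col_mulmx (R : realType) (m n p : nat) (A : 'M[R]_(m, n))
    (B : 'M[R]_(n, p)) (j : 'I_p) :
  col j (A *m B) = A *m col j B.
Proof. by rewrite !colE mulmxA. Qed.

Lemma Umx0 (R : realType) (n : nat) (S : 'M[R]_n) : Umx S ord0 = S.
Proof. by rewrite /Umx unlift_none. Qed.

Lemma col_Umx_lift (R : realType) (n : nat) (S : 'M[R]_n) (l j : 'I_n) :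
  col j (Umx S (lift ord0 l)) =
  (if j == l then 0 else col j S) - col l S.
Proof.
apply/matrixP=> r c; rewrite /Umx liftK !mxE.
by case: eqP => _; rewrite !mxE ?sub0r.
Qed.

Lemma col_Umx_vertex (R : realType) (n : nat) (S : 'M[R]_n) (k : 'I_n.+1)
    (j : 'I_n) :
  exists2 a, a != k & col j (Umx S k) = vertex S a - vertex S k.
Proof.
case: (unliftP ord0 k) => [l|] ->.
  rewrite col_Umx_lift vertex_lift; case: (eqVneq j l) => [_|jl].
    by exists ord0; rewrite ?vertex0 // neq_lift.
  by exists (lift ord0 j); rewrite ?vertex_lift.
exists (lift ord0 j); first by rewrite eq_sym neq_lift.
by rewrite Umx0 vertex_lift vertex0 subr0.
Qed.

Lemma vertex_col_Umx (R : realType) (n : nat) (S : 'M[R]_n) (k a : 'I_n.+1) :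
  a != k -> exists j, col j (Umx S k) = vertex S a - vertex S k.
Proof.
case: (unliftP ord0 k) => [l|] ->; case: (unliftP ord0 a) => [j|] -> //.
- rewrite (inj_eq lift_inj) => jl; exists j.
  by rewrite col_Umx_lift (negPf jl) !vertex_lift.
- by move=> _; exists l; rewrite col_Umx_lift eqxx vertex_lift vertex0.
- by move=> _; exists j; rewrite Umx0 vertex0 subr0 vertex_lift.
Qed.

(** With b = k the lattice point is x0 + v_a, that is, x0 itself or some
    x0 + s^i.  If neither index is k, then v_b - v_k is a column of U_k, and the
    point is x0 + t^j or x0 + s^i + t^j according to whether a = 0 or not. *)
Lemma nested_points_lattice (R : realType) (n : nat) (x0 : 'cV[R]_n)
    (S : 'M[R]_n) (k : 'I_n.+1) (y : 'cV[R]_n) :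
  y \in nested_points x0 S (Umx S k) <->
  exists a b, y = x0 - vertex S k + (vertex S a + vertex S b).
Proof.
have first_order a : x0 + vertex S a \in nested_points x0 S (Umx S k).
  rewrite !in_fsetU; case: (unliftP ord0 a) => [i|] ->.
    rewrite vertex_lift; apply/orP; left; apply/orP; left; apply/orP; right.
    exact: in_imfset.
  by rewrite vertex0 addr0 in_fset1 eqxx.
split=> [|[a] [b] ->].
  rewrite !in_fsetU -!orbA; case/or4P.
  - rewrite in_fset1 => /eqP->; exists k, ord0.
    by rewrite vertex0 addr0 subrK.
  - case/imfsetP=> i _ ->; exists (lift ord0 i), k.
    by rewrite vertex_lift [col i S + _]addrC addrA subrK.
  - case/imfsetP=> j _ ->; have [a _ ->] := col_Umx_vertex S k j.
    by exists ord0, a; rewrite vertex0 add0r [vertex S a - _]addrC addrA.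
  - case/imfset2P=> i _ [j _ ->]; have [a _ ->] := col_Umx_vertex S k j.
    exists (lift ord0 i), a; rewrite vertex_lift.
    by rewrite [vertex S a - _]addrC !addrA [x0 + _ - _]addrAC.
have [->|ak] := eqVneq a k; first by rewrite addrA subrK.
have [->|bk] := eqVneq b k; first by rewrite [vertex S a + _]addrC addrA subrK.
have [j tj] := vertex_col_Umx S bk.
rewrite !in_fsetU; case: (unliftP ord0 a) => [i|] ->.
  apply/orP; right; apply/imfset2P; exists i => //; exists j => //.
  by rewrite tj vertex_lift [vertex S b - _]addrC !addrA [x0 + _ - _]addrAC.
apply/orP; left; apply/orP; right; apply/imfsetP; exists j => //.
by rewrite tj vertex0 add0r [vertex S b - _]addrC addrA.
Qed.

(** Unordered pairs are represented with the larger index first, so that the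
    count is the triangular sum over that index. *)
Lemma card_ordered_pairs (m : nat) :
  #|[pred p : 'I_m * 'I_m | (p.2 <= p.1)%N]| = ((m * m.+1)./2)%N.
Proof.
rewrite -sum1_card -(pair_big_dep predT (fun i j : 'I_m => (j <= i)%N)
  (fun _ _ => 1%N)) /=.
rewrite (eq_bigr (fun i : 'I_m => i.+1)) => [|i _]; last first.
  by rewrite -(big_ord_widen _ (fun=> 1%N) (ltn_ord i)) sum1_card card_ord.
by rewrite mulnC -[m in (_ * m)%N]/(m.+1.-1) -bin2 -bin2_sum big_mkord
  big_ord_recl add0n.
Qed.

(** The larger entry of a pair is its largest positive entry, or 0 if there is
    none, so the two larger entries agree; once they are cancelled, the same
    argument applies to the smaller ones. *)
Lemma ordered_pair_inj (a b a' b' : nat) : (b <= a)%N -> (b' <= a')%N ->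
  (forall x, (0 < x)%N -> ((a == x) + (b == x) = (a' == x) + (b' == x))%N) ->
  a = a' /\ b = b'.
Proof.
have le_max (c d c' d' : nat) : (d' <= c')%N ->
    (forall x, (0 < x)%N -> ((c == x) + (d == x) = (c' == x) + (d' == x))%N) ->
    (c <= c')%N.
  move=> dc' mult; rewrite leqNgt; apply/negP => c'c.
  have := mult c (leq_ltn_trans (leq0n c') c'c).
  by rewrite eqxx (ltn_eqF c'c) (ltn_eqF (leq_ltn_trans dc' c'c)).
move=> ba ba' mult.
have aa' : a = a'.
  apply/eqP; rewrite eqn_leq (le_max _ _ _ _ ba' mult) (le_max a' b' _ _ ba) //.
  by move=> x /mult.
split=> //; rewrite -{}aa' in mult.
have [b0|bpos] := posnP b.
  have [->//|b'pos] := posnP b'.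
  by move/addnI: (mult b' b'pos); rewrite eqxx; case: eqP.
by move/addnI: (mult b bpos); rewrite eqxx eq_sym; case: eqP.
Qed.

(** The vector v_a + v_b has i-th coordinate [a = i] + [b = i] in the basis
    s^1, ..., s^n, so it gives the multiplicity in the multiset {a, b} of every
    index except 0; since {a, b} has two elements, this determines it. *)
Lemma vertex_pair_inj (R : realType) (n : nat) (S : 'M[R]_n)
    (a b a' b' : 'I_n.+1) :
  S \in unitmx -> (b <= a)%N -> (b' <= a')%N ->
  vertex S a + vertex S b = vertex S a' + vertex S b' -> (a, b) = (a', b').
Proof.
move=> uS ba ba' E.
have coord (i : 'I_n) (c : 'I_n.+1) :
    (invmx S *m vertex S c) i 0 = (c == lift ord0 i :> nat)%:R.
  case: (unliftP ord0 c) => [j|] ->; last by rewrite vertex0 mulmx0 mxE.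
  rewrite vertex_lift -col_mulmx mulVmx // !mxE eq_sym.
  by rewrite (inj_eq val_inj) (inj_eq lift_inj).
have [x x0|aa' bb'] := ordered_pair_inj ba ba'; last first.
  by congr pair; apply: val_inj.
(* Indices beyond n occur in neither pair. *)
have [xn|nx] := ltnP x n.+1; last first.
  by rewrite !ltn_eqF // (leq_trans (ltn_ord _) nx).
case: (unliftP ord0 (Ordinal xn)) => [i|] xi; last by move: x0; case: xi => ->.
have -> : x = lift ord0 i by rewrite -xi.
move/(congr1 (fun v => (invmx S *m v) i 0)): E.
rewrite !mulmxDr [X in X = _ -> _]mxE [X in _ = X -> _]mxE.
by rewrite !coord -!natrD => /eqP; rewrite eqr_nat => /eqP.
Qed.

Lemma card_nested_points (R : realType) (n : nat) (x0 : 'cV[R]_n)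
    (S : 'M[R]_n) (k : 'I_n.+1) :
  S \in unitmx ->
  #|` nested_points x0 S (Umx S k)| = ((n.+1 * n.+2)./2)%N.
Proof.
move=> uS; pose f (p : 'I_n.+1 * 'I_n.+1) :=
  x0 - vertex S k + (vertex S p.1 + vertex S p.2).
pose P := [pred p : 'I_n.+1 * 'I_n.+1 | (p.2 <= p.1)%N].
have -> : nested_points x0 S (Umx S k) = [fset f p | p in P].
  apply/fsetP=> y; apply/idP/imfsetP => /=.
    case/nested_points_lattice=> a [b ->].
    have [ba|ab] := leqP b a; first by exists (a, b).
    by exists (b, a); rewrite ?inE /= ?(ltnW ab) // /f /= [vertex S b + _]addrC.
  by case=> -[a b] _ ->; apply/nested_points_lattice; exists a, b.
rewrite card_in_imfset => [|[a b] [a' b']].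
  by rewrite -card_ordered_pairs cardE.
by rewrite !inE /f /= => ba ba' /addrI; apply: vertex_pair_inj.
Qed.

Lemma Umx_mulmx (R : realType) (n : nat) (A B : 'M[R]_n) (k : 'I_n.+1) :
  Umx (A *m B) k = A *m Umx B k.
Proof.
rewrite /Umx; case: (unlift ord0 k) => // l.
apply/matrixP=> r i; rewrite !mxE; case: eqVneq => il.
  by rewrite -sumrN; apply: eq_bigr => j _; rewrite !mxE il eqxx mulrN.
by rewrite -sumrB; apply: eq_bigr => j _; rewrite !mxE (negPf il) mulrBr.
Qed.

Lemma UmxK (R : realType) (n : nat) (S : 'M[R]_n) (k : 'I_n.+1) :
  Umx (Umx S k) k = S.
Proof.
rewrite /Umx; case: (unlift ord0 k) => // l.
apply/matrixP=> r i; rewrite !mxE eqxx; case: eqVneq => [->|_].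
  by rewrite opprK.
by rewrite opprK subrK.
Qed.

(** Since U_k = S E, with E the matrix obtained in the same way from the
    identity, the involution property says that S = U_k E. *)
Lemma Umx_unit (R : realType) (n : nat) (S : 'M[R]_n) (k : 'I_n.+1) :
  S \in unitmx -> Umx S k \in unitmx.
Proof.
have SE : Umx S k *m Umx 1%:M k = S by rewrite -Umx_mulmx mulmx1 UmxK.
by rewrite -{1}SE unitmx_mul => /andP[].
Qed.

Lemma quad_form_sym (R : realType) (n : nat) (H : 'M[R]_n) (u w : 'cV[R]_n) :
  H^T = H -> (u^T *m H *m w) 0 0 = (w^T *m H *m u) 0 0.
Proof.
move=> symH; have <- : (u^T *m H *m w)^T = w^T *m H *m u.
  by rewrite !trmx_mul trmxK symH mulmxA.
by rewrite [RHS]mxE.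
Qed.

(** Taylor expansion of a quadratic at c. *)
Lemma quad_evalD (R : realType) (n : nat) (a0 : R) (a : 'cV[R]_n)
    (H : 'M[R]_n) (c d : 'cV[R]_n) :
  H^T = H ->
  quad_eval a0 a H (c + d) = quad_eval (quad_eval a0 a H c) (a + H *m c) H d.
Proof.
move=> symH; have entryD (A B : 'M[R]_1) : (A + B) 0 0 = A 0 0 + B 0 0.
  by rewrite mxE.
rewrite /quad_eval [(c + d)^T]linearD [(a + _)^T]linearD /= trmx_mul symH.
rewrite !mulmxDl !mulmxDr !entryD (quad_form_sym d c symH).
by field.
Qed.

(** The second difference F(s^i + s^j) - F(s^i) - F(s^j) + F(0) isolates the
    entry s^i.H s^j of the Gram matrix S^T H S. *)
Lemma quad_lattice_eq0 (R : realType) (n : nat) (S : 'M[R]_n) (b0 : R)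
    (b : 'cV[R]_n) (H : 'M[R]_n) :
  S \in unitmx -> H^T = H ->
  (forall i j, quad_eval b0 b H (vertex S i + vertex S j) = 0) ->
  [/\ b0 = 0, b = 0 & H = 0].
Proof.
move=> uS symH F0.
have b00 : b0 = 0.
  have := F0 ord0 ord0; rewrite vertex0 addr0 /quad_eval !mulmx0 !mxE.
  by rewrite mulr0 !addr0.
have Fs i : quad_eval b0 b H (col i S) = 0.
  by rewrite -(F0 (lift ord0 i) ord0) vertex_lift vertex0 addr0.
have gram i j : ((col i S)^T *m H *m col j S) 0 0 = 0.
  (* F(s^i + s^j) is expanded at s^i, where F vanishes; this leaves
     b.s^j + s^i.H s^j + s^j.H s^j / 2, of which F(s^j) is all but one term. *)
  have := F0 (lift ord0 i) (lift ord0 j); rewrite !vertex_lift quad_evalD //.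
  rewrite Fs; move: (Fs j); rewrite b00 /quad_eval linearD /= trmx_mul symH.
  rewrite mulmxDl [in X in _ -> X]mxE; lra.
have H0 : H = 0.
  have SHS0 : S^T *m H *m S = 0.
    apply/matrixP=> i j; rewrite [RHS]mxE -(gram i j).
    by rewrite tr_col -row_mul -col_mulmx -row_mul !mxE.
  have uST : S^T \in unitmx by rewrite unitmx_tr.
  by rewrite -[H](mulKmx uST) -[_ *m H](mulmxK uS) SHS0 mul0mx mulmx0.
split=> //.
have bS0 : b^T *m S = 0.
  apply/matrixP=> i j; rewrite [i]ord1 [RHS]mxE.
  have := Fs j; rewrite b00 H0 /quad_eval mulmx0 mul0mx [(0 : 'M_1) _ _]mxE.
  by rewrite mulr0 addr0 add0r -col_mulmx mxE.
by rewrite -[b]trmxK -[b^T](mulmxK uS) bS0 mul0mx trmx0.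
Qed.

Theorem proposition3p6 (R : realType) (n : nat) (x0 : 'cV[R]_n)
    (S : 'M[R]_n) (hS : \rank S = n) (k : 'I_n.+1) :
  minimal_poised_nshc x0 S (Umx S k) /\
  poised_quadratic (nested_points x0 S (Umx S k)).
Proof.
have uS : S \in unitmx by rewrite -row_full_unit /row_full hS.
have cardY := card_nested_points x0 k uS.
split; first by split=> //; apply: mxrank_unit; apply: Umx_unit.
split=> //; exists (0, 0, 0); split=> [|[[a0 a] H] /= [symH vanish]].
  split=> [|y _] /=; first exact: trmx0.
  by rewrite /quad_eval trmx0 mulmx0 !mul0mx !mxE mulr0 !addr0.
(* The recentred coefficients vanish; H = 0 then gives a = 0 and a0 = 0. *)
pose c := x0 - vertex S k.
have [i j|c0 ac0 H0] := @quad_lattice_eq0 R n S (quad_eval a0 a H c)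
  (a + H *m c) H uS symH.
  rewrite -quad_evalD //; apply: vanish.
  by apply/nested_points_lattice; exists i, j.
move: ac0 c0; rewrite H0 mul0mx addr0 => ->.
by rewrite /quad_eval trmx0 mulmx0 !mul0mx !mxE mulr0 !addr0 => ->.
Qed.
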